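(* Let $B$ be a symmetric positive definite $d\times d$ real matrix and let $\gamma^t\in(0,1)$ for all integers $t\ge 0$. Let $(x_i^0)_{i\in\{1,\dots,n\}}\in(\mathbb{R}^d)^n$ be an initial configuration, let $\mathcal{K}:=\mathrm{conv}\{x_i^0\}_{i\in\{1,\dots,n\}}$ and let $v=(v_1,\dots,v_\kappa)$ be the vertices of $\mathcal{K}$. Assume that 1. for every $j\in\{1,\dots,\kappa\}$, $v_j\in\mathscr{C}_j(v)\setminus\bigcup_{i\ne j}\mathscr{C}_i(v)$; 2. if $x_i^0$ is not a vertex of $\mathcal{K}$, then it does not lie on any face shared by two adjacent cells, i.e. $x_i^0\notin\mathscr{C}_k(v)\cap\mathscr{C}_l(v)$ for $k\neq l$. Then the map $\sigma:\{1,\dots,n\}\to\{1,\dots,\kappa\}$ such that $x_i^0\in\mathscr{C}_{\sigma(i)}(v)$ is well-defined, and the particles evolving according to $$x_i^{t+1}=x_i^t+\gamma^t\left(\operatorname*{arg\,max}_{y\in\mathcal{K}^t}\langle Bx_i^t,y\rangle-x_i^t\right),\qquad \mathcal{K}^t:=\mathrm{conv}\{x_j^t\}_{j\in\{1,\dots,n\}},$$ satisfy $$x_i^t=\left(\prod_{\tau=0}^{t-1}(1-\gamma^\tau)\right)x_i^0+\sum_{\tau=0}^{t-1}\left(\gamma^\tau\prod_{s=\tau+1}^{t-1}(1-\gamma^s)\right)v_{\sigma(i)}$$ for all $i\in\{1,\dots,n\}$ and $t\ge 0$. In particular, $x_i^t$ converges to $v_{\sigma(i)}$ at least exponentially fast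 as $t\to+\infty$ (that is, there are constants $C,c>0$ with $\|x_i^t-v_{\sigma(i)}\|\le Ce^{-ct}$ for all $t\ge 0$).
   Context: $\langle\cdot,\cdot\rangle$ and $\|\cdot\|$ are the Euclidean inner product and norm on $\mathbb{R}^d$, and $\mathrm{conv}$ is the convex hull. For a convex polytope $\mathcal{K}\subset\mathbb{R}^d$ with vertices $v=(v_1,\dots,v_\kappa)$ and a square matrix $B$, the cells are $$\mathscr{C}_i(v):=\left\{x\in\mathcal{K}:\ \langle Bx,v_i\rangle=\max_{y\in\mathcal{K}}\langle Bx,y\rangle\right\},\qquad i\in\{1,\dots,\kappa\}.$$ The symbol $\arg\max$ in the update denotes the maximizer, treated as a single point. Empty products equal $1$ and empty sums equal $0$. The superscript $\tau$ or $s$ on $\gamma$ is a time index, not a power.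
   Formalization: The exponential convergence is proved only when the steps γ^t are bounded below by some δ>0; for merely γ^t∈(0,1) it is false (e.g. d=1, B=1, x^0=(1,-1,1/2), γ^t=1/(t+2)^2 gives x_3^t→3/4, not 1). *)

(* Defs.v *)
From HB Require Import structures.
From mathcomp Require Import all_boot all_order all_algebra.
From mathcomp Require Import all_classical all_reals all_analysis.

Set Implicit Arguments.
Unset Strict Implicit.
Unset Printing Implicit Defensive.

Import Order.TTheory GRing.Theory Num.Theory.
Local Open Scope classical_set_scope.
Local Open Scope ring_scope.

Section Defs.
Context {R : realType} {d : nat}.
Implicit Types (x y : 'cV[R]_d) (K : set 'cV[R]_d) (B : 'M[R]_d).

(* The library norm on matrices is the sup norm, hence these two. *)
Definition inner x y : R := \sum_(k < d) x k 0 * y k 0.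
Definition enorm x : R := Num.sqrt (inner x x).

Definition sym_posdef B : Prop :=
  B^T = B /\ forall x, x != 0 -> 0 < inner (B *m x) x.

Definition convex_hull K : set 'cV[R]_d :=
  smallest (@convex_set R 'cV[R]_d) K.

(* For a convex polytope, the vertices are the extreme points. *)
Definition vertices K : set 'cV[R]_d :=
  [set p | K p /\ forall x y (t : R), K x -> K y -> 0 < t < 1 ->
                    p = t *: x + (1 - t) *: y -> x = p /\ y = p].

Definition is_max (A : set R) (m : R) : Prop := A m /\ ubound A m.

(* The full set of maximizers. *)
Definition argmax K (f : 'cV[R]_d -> R) : set 'cV[R]_d :=
  [set y | K y /\ is_max (f @` K) (f y)].

Definition cell B K (kappa : nat) (v : 'I_kappa -> 'cV[R]_d) (i : 'I_kappa) :
    set 'cV[R]_d :=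
  [set x | K x /\ is_max (inner (B *m x) @` K) (inner (B *m x) (v i))].

(* [x t i] is the position of particle [i] at time [t].  A trajectory may pick
   any maximizer at each step: uniqueness of the maximizer is not assumed. *)
Definition hardmax_flow B (gamma : nat -> R) (n : nat)
    (x : nat -> 'I_n -> 'cV[R]_d) : Prop :=
  forall t i, exists2 y,
    argmax (convex_hull (range (x t))) (inner (B *m x t i)) y &
    x t.+1 i = x t i + gamma t *: (y - x t i).

End Defs.

(* Main.v *)
(** Each [x t i] stays on the segment from [x0 i] to [v (sigma i)], with a positive
    weight on [x0 i]; the particles starting at the vertices do not move, so the
    hull never changes. As [x0 i] lies in one cell only, the linear form
    [<B (x0 i), .>] is strictly smaller at every other vertex, and since the hull
    is generated by its vertices, [v (sigma i)] is its unique maximizer. It also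
    maximizes [<B (v (sigma i)), .>], hence it remains the unique maximizer for
    every point of the half-open segment, and the next step moves along the same
    segment. *)
Require Import Defs.
From HB Require Import structures.
From mathcomp Require Import all_boot all_order all_algebra.
From mathcomp Require Import all_classical all_reals all_analysis.
From mathcomp Require Import ring.

Set Implicit Arguments.
Unset Strict Implicit.
Unset Printing Implicit Defensive.

Import Order.TTheory GRing.Theory Num.Theory.
Local Open Scope classical_set_scope.
Local Open Scope ring_scope.

(** * Convex hulls, extreme points and affine functions *)

Section ConvexHull.
Context {R : realType} {d : nat}.
Implicit Types (x y p : 'cV[R]_d) (G H K : set 'cV[R]_d) (t : R).

(** Real weights in the open interval replace the library's bundled weights, and the trivial
    endpoint cases drop out of later convexity proofs. *)
Lemma convex_setP K : @convex_set R 'cV[R]_d K <->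
  forall x y t, K x -> K y -> 0 < t < 1 -> K (t *: x + (1 - t) *: y).
Proof.
split=> [cK x y t Kx Ky /andP[t0 t1]|cK].
  apply/set_mem; exact: (cK x y (Itv01 (ltW t0) (ltW t1))) (mem_set Kx) (mem_set Ky).
apply/convex_setW => x y xK yK k k0 k1; apply/mem_set.
by apply: cK; [exact: set_mem xK|exact: set_mem yK|rewrite k0 k1].
Qed.

(** Serves as the induction principle for hulls: [K] is the property to be propagated from the
    generators. *)
Lemma convex_hull_min G K :
  (forall x y t, K x -> K y -> 0 < t < 1 -> K (t *: x + (1 - t) *: y)) ->
  G `<=` K -> convex_hull G `<=` K.
Proof. by move=> /convex_setP cK; exact: smallest_sub. Qed.

Lemma convex_hull_sub G : G `<=` convex_hull G.
Proof. exact: sub_gen_smallest. Qed.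

Lemma convex_hull_convex G x y t : convex_hull G x -> convex_hull G y ->
  0 <= t <= 1 -> convex_hull G (t *: x + (1 - t) *: y).
Proof.
move=> Gx Gy /andP[t0 t1].
have [->|tn0] := eqVneq t 0; first by rewrite scale0r add0r subr0 scale1r.
have [->|tn1] := eqVneq t 1; first by rewrite subrr scale0r addr0 scale1r.
move=> K [cK GK]; move/convex_setP : (cK); apply.
- by apply: Gx; split.
- by apply: Gy; split.
- by rewrite !lt_neqAle t0 t1 tn1 eq_sym tn0.
Qed.

Lemma convex_hull_idem G H :
  H `<=` convex_hull G -> convex_hull H `<=` convex_hull G.
Proof.
apply: convex_hull_min => x y t Gx Gy /andP[t0 t1].
by apply: convex_hull_convex => //; rewrite !ltW.
Qed.

Lemma convex_hullS G H : G `<=` H -> convex_hull G `<=` convex_hull H.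
Proof. by move=> GH; apply: convex_hull_idem => x /GH /convex_hull_sub. Qed.

Lemma vertices_sub_generators G : vertices (convex_hull G) `<=` G.
Proof.
move=> p [Gp extp]; apply: contrapT => nGp.
(* Removing an extreme point from a convex set leaves a convex set. *)
suff /(_ p Gp)[] : convex_hull G `<=` [set y | convex_hull G y /\ y <> p] by [].
apply: convex_hull_min => [x y t [Gx xp] [Gy yp] t01|x Gx].
  split; last by move=> /esym /(extp _ _ _ Gx Gy t01)[].
  case/andP: t01 => t0 t1.
  by apply: convex_hull_convex => //; rewrite !ltW.
by split; [exact: convex_hull_sub|move=> xp; apply: nGp; rewrite -xp].
Qed.

(* The half-open join of [p] and [H] is convex, absorbs segments towards [p],
   and misses [p]: hence [p] is extreme in the join. *)
Lemma vertices_cone_apex p H : ~ convex_hull H p ->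
  vertices (convex_hull (p |` H)) p.
Proof.
move=> nHp.
pose S := [set y | exists h s, [/\ convex_hull H h, 0 <= s < 1 &
                                   y = s *: p + (1 - s) *: h]].
have SS x y t : S x -> S y -> 0 < t < 1 -> S (t *: x + (1 - t) *: y).
  move=> [h [s [Hh /andP[s0 s1] ->]]] [h' [s' [Hh' /andP[s0' s1'] ->]]].
  move=> /andP[t0 t1].
  have a0 : 0 < t * (1 - s) by rewrite mulr_gt0 ?subr_gt0.
  have b0 : 0 < (1 - t) * (1 - s') by rewrite mulr_gt0 ?subr_gt0.
  set a := t * (1 - s) in a0; set b := (1 - t) * (1 - s') in b0.
  have abE : 1 - (t * s + (1 - t) * s') = a + b by rewrite /a /b; ring.
  have ab0 : a + b != 0 by rewrite gt_eqF ?addr_gt0.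
  (* The apex receives the averaged weight; the remaining mass [a + b] is shared between [h] and
     [h'] in proportion to [a] and [b]. *)
  exists (a / (a + b) *: h + (1 - a / (a + b)) *: h'), (t * s + (1 - t) * s').
  split.
  - apply: convex_hull_convex => //; apply/andP; split.
      by rewrite divr_ge0 ?addr_ge0 ?ltW.
    by rewrite ler_pdivrMr ?addr_gt0// mul1r lerDl ltW.
  - apply/andP; split; first by rewrite addr_ge0// mulr_ge0// ?subr_ge0 ltW.
    by rewrite -subr_gt0 abE addr_gt0.
  - apply/colP => k; rewrite !mxE abE.
    have -> (u w : R) :
        (a + b) * (a / (a + b) * u + (1 - a / (a + b)) * w) = a * u + b * w.
      by field.
    by rewrite /a /b; ring.
have Sp x t : S x -> 0 < t <= 1 -> S (t *: x + (1 - t) *: p).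
  move=> [h [s [Hh /andP[s0 s1] ->]]] /andP[t0 t1].
  exists h, (t * s + (1 - t)); split=> //.
    apply/andP; split; first by rewrite addr_ge0 ?mulr_ge0 ?subr_ge0 ?(ltW t0).
    rewrite -subr_gt0.
    have -> : 1 - (t * s + (1 - t)) = t * (1 - s) by ring.
    by rewrite mulr_gt0 ?subr_gt0.
  by apply/colP => k; rewrite !mxE; ring.
have pS y t : S y -> 0 <= t < 1 -> S (t *: p + (1 - t) *: y).
  move=> Sy /andP[t0 t1]; have := Sp y (1 - t) Sy.
  by rewrite subKr [_ *: p + _]addrC subr_gt0 t1 gerBl t0; apply.
have nSp : ~ S p.
  move=> [h [s [Hh /andP[s0 s1] /eqP]]].
  (* The equation becomes [(1 - s) *: (p - h) = 0]; as [s < 1], it forces [p = h], a point of the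
     hull of [H]. *)
  rewrite -subr_eq0 opprD addrA -{1}[p]scale1r -scalerBl -scalerBr scaler_eq0.
  by rewrite subr_eq0 gt_eqF//= subr_eq0 => /eqP ph; apply: nHp; rewrite ph.
have hullS : convex_hull (p |` H) `<=` [set y | y = p \/ S y].
  apply: convex_hull_min => [x y t [->|Sx] [->|Sy] /andP[t0 t1]|y [->|Hy]].
  - by left; rewrite -scalerDl addrC subrK scale1r.
  - by right; apply: pS => //; rewrite t1 ltW.
  - by right; apply: Sp => //; rewrite t0 ltW.
  - by right; apply: SS => //; rewrite t0.
  - by left.
  - right; exists y, 0; rewrite lexx ltr01 scale0r add0r subr0 scale1r.
    by split=> //; exact: convex_hull_sub.
split; first by apply: convex_hull_sub; left.
move=> x y t /hullS + /hullS + /andP[t0 t1].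
move=> [->|Sx] [->|Sy] pE //; exfalso; apply: nSp; rewrite pE.
- by apply: pS => //; rewrite t1 ltW.
- by apply: Sp => //; rewrite t0 ltW.
- by apply: SS => //; rewrite t0.
Qed.

(** Minkowski's theorem for a polytope. Take a minimal set [A] of indices whose points still
    generate [K]: no [u j] with [j] in [A] lies in the hull of the others, so each is the apex of a
    cone over them and hence extreme. Minimizing over indices also discards repeated points. *)
Lemma convex_hull_vertices (I : finType) (u : I -> 'cV[R]_d)
    (K := convex_hull (range u)) : K `<=` convex_hull (vertices K).
Proof.
pose P (A : {set I}) := `[< range u `<=` convex_hull (u @` [set` A]) >].
have /ex_minset[A /minsetP[/asboolP PA minA]] : exists A, P A.
  exists [set: I]%SET; apply/asboolP => _ [i _ <-]; apply: convex_hull_sub.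
  by exists i => //=; rewrite inE.
apply: convex_hull_idem => _ [i _ <-].
have := PA (u i) (imageT u i).
apply: convex_hull_idem => _ [j /= jA <-]; apply: convex_hull_sub.
have KE : K = convex_hull (u j |` (u @` [set` A :\ j]%SET)).
  apply/seteqP; split; last first.
    by apply: convex_hullS => _ [->|[k _ <-]]; [exists j|exists k].
  apply: convex_hull_idem => x /PA; apply: convex_hullS => _ [k /= kA <-].
  have [->|kj] := eqVneq k j; first by left.
  by right; exists k => //=; rewrite !inE kj.
rewrite KE; apply: vertices_cone_apex => uj.
have : (A :\ j)%SET = A.
  apply: minA; last exact: subsetDl.
  apply/asboolP => x /PA; apply: convex_hull_idem => _ [k /= kA <-].
  have [->//|kj] := eqVneq k j.
  by apply: convex_hull_sub; exists k => //=; rewrite !inE kj.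
by move=> /setP/(_ j); rewrite !inE eqxx/= jA.
Qed.

Lemma convex_hull0 x : ~ convex_hull set0 x.
Proof. by apply: (@convex_hull_min set0 set0 _ _ x). Qed.

Section Affine.
Variable f : 'cV[R]_d -> R.
Hypothesis f_affine :
  forall x y t, f (t *: x + (1 - t) *: y) = t * f x + (1 - t) * f y.

Lemma affine_le_hull G m :
  (forall g, G g -> f g <= m) -> forall y, convex_hull G y -> f y <= m.
Proof.
move=> Gm; apply: (@convex_hull_min _ [set y | f y <= m])=> //.
move=> x y t /= fx fy /andP[t0 t1].
rewrite f_affine.
have -> : m = t * m + (1 - t) * m by ring.
by rewrite lerD// ler_wpM2l// ?subr_ge0 ltW.
Qed.

(** The alternative survives mixing: a proper convex combination is [p] if both ends are, and
    otherwise at least one end contributes a strict inequality. *)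
Lemma affine_lt_hull G p : (forall g, G g -> g = p \/ f g < f p) ->
  forall y, convex_hull G y -> y = p \/ f y < f p.
Proof.
move=> Gp; apply: (@convex_hull_min _ [set y | y = p \/ f y < f p])=> //.
move=> x y t /= xp yp /andP[t0 t1].
rewrite f_affine.
have t1' : 0 < 1 - t by rewrite subr_gt0.
have [fpE le_lt] : f p = t * f p + (1 - t) * f p /\
    forall z, z = p \/ f z < f p -> f z <= f p.
  by split; [ring|move=> z [->//|/ltW]].
case: (xp) (yp) => [->|fx] [->|fy].
- by left; rewrite -scalerDl addrC subrK scale1r.
- by right; rewrite [ltRHS]fpE ltrD2l ltr_pM2l.
- by right; rewrite [ltRHS]fpE ltrD2r ltr_pM2l.
- by right; rewrite [ltRHS]fpE ltrD// ltr_pM2l.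
Qed.

End Affine.

End ConvexHull.

(** * Bilinearity of the inner product and homogeneity of the norm *)

Section Inner.
Context {R : realType} {d : nat}.
Implicit Types (x y z : 'cV[R]_d) (a b : R).

Lemma innerC x y : inner x y = inner y x.
Proof. by apply: eq_bigr => k _; rewrite mulrC. Qed.

Lemma inner_combr z x y a b :
  inner z (a *: x + b *: y) = a * inner z x + b * inner z y.
Proof.
rewrite /inner !mulr_sumr -big_split/=; apply: eq_bigr => k _.
by rewrite !mxE; ring.
Qed.

Lemma inner_mulmx_combl (B : 'M[R]_d) z x y a b :
  inner (B *m (a *: x + b *: y)) z = a * inner (B *m x) z + b * inner (B *m y) z.
Proof.
by rewrite mulmxDr -!scalemxAr innerC inner_combr !(innerC z).
Qed.

Lemma enormZ a x : 0 <= a -> enorm (a *: x) = a * enorm x.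
Proof.
move=> a0; rewrite /enorm; have -> : inner (a *: x) (a *: x) = a ^+ 2 * inner x x.
  by rewrite /inner mulr_sumr; apply: eq_bigr => k _; rewrite !mxE; ring.
by rewrite sqrtrM ?sqr_ge0// sqrtr_sqr ger0_norm.
Qed.

End Inner.

(** The weights of a convex combination add up to 1: passing from [t] to [t.+1] scales the old
    weights by [1 - gamma t] and adds the new weight [gamma t]. *)
Lemma sum_weights {R : realType} {V : lmodType R} (gamma : nat -> R) (w : V) t :
  \sum_(0 <= tau < t) (gamma tau * \prod_(tau.+1 <= s < t) (1 - gamma s)) *: w =
  (1 - \prod_(0 <= tau < t) (1 - gamma tau)) *: w.
Proof.
rewrite -scaler_suml; congr (_ *: w); elim: t => [|t IH].
  by rewrite !big_nil subrr.
rewrite big_nat_recr//= [X in gamma t * X]big_geq// mulr1.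
rewrite [X in 1 - X]big_nat_recr//=.
have -> : \sum_(0 <= i < t) gamma i * \prod_(i.+1 <= s < t.+1) (1 - gamma s) =
    (\sum_(0 <= i < t) gamma i * \prod_(i.+1 <= s < t) (1 - gamma s)) *
      (1 - gamma t).
  rewrite mulr_suml; apply: eq_big_nat => i /andP[_ it].
  by rewrite big_nat_recr//= mulrA.
by rewrite IH; ring.
Qed.

(** * Cells of the initial polytope and the dynamics *)

Section Flow.
Context {R : realType} {d n kappa : nat} (B : 'M[R]_d) (gamma : nat -> R).
Context (x0 : 'I_n -> 'cV[R]_d) (v : 'I_kappa -> 'cV[R]_d).
Let K := convex_hull (range x0).
Let C := cell B K v.
Hypothesis Hgamma : forall t, 0 < gamma t < 1.
Hypothesis v_vertices : range v = vertices K.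

Let a t := \prod_(0 <= tau < t) (1 - gamma tau).

Lemma decay_gt0_le1 t : 0 < a t <= 1.
Proof.
elim: t => [|t /andP[a0 a1]]; first by rewrite /a big_nil ltr01 lexx.
have /andP[g0 g1] := Hgamma t.
rewrite /a big_nat_recr//= mulr_gt0 ?subr_gt0//=.
by rewrite mulr_ile1 ?subr_ge0 ?(ltW a0) ?(ltW g1)// gerBl ltW.
Qed.

Lemma K_sub_hull_v : K `<=` convex_hull (range v).
Proof. by rewrite v_vertices; exact: convex_hull_vertices. Qed.

Lemma K_v j : K (v j).
Proof. by have [] : vertices K (v j) by rewrite -v_vertices; exists j. Qed.

(** A linear form bounded at the vertices is bounded on their hull, so membership in a cell is a
    finite comparison. *)
Lemma cellP x i : K x ->
  (forall j, inner (B *m x) (v j) <= inner (B *m x) (v i)) -> C i x.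
Proof.
move=> Kx vle; split=> //; split; first by exists (v i) => //; exact: K_v.
move=> _ [y /K_sub_hull_v Ky <-].
apply: (affine_le_hull _ _ Ky) => [*|_ [j _ <-]//]; exact: inner_combr.
Qed.

Lemma cell_exists x : K x -> exists k, C k x.
Proof.
move=> Kx.
(* With no vertex at all, [K] would lie in the hull of the empty set, contradicting [K x]. *)
have [j0 _|no] := pickP (@predT 'I_kappa); last first.
  have /K_sub_hull_v := Kx; rewrite (_ : range v = set0); first by move=> /convex_hull0.
  by apply/seteqP; split=> // y [j _ _]; have := no j.
have [k _ kmax] := @arg_maxP _ _ _ j0 predT (fun j => inner (B *m x) (v j)) isT.
by exists k; apply: cellP => // j; exact: kmax.
Qed.

Lemma cell_unique_max x k : (forall l, C l x -> l = k) -> C k x ->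
  forall y, K y -> y = v k \/ inner (B *m x) y < inner (B *m x) (v k).
Proof.
move=> uk [Kx [_ kub]] y /K_sub_hull_v; apply: affine_lt_hull => [*|].
  exact: inner_combr.
move=> _ [j _ <-]; have [<-|jk] := eqVneq j k; [by left|right].
(* If [v j] did as well as [v k], it would be a maximizer too, and [x] would lie in cell [j]. *)
rewrite ltNge; apply: contra_neqN jk => kj; apply: uk; apply: cellP => // l.
by apply: le_trans kj; apply: kub; exists (v l) => //; exact: K_v.
Qed.

Lemma hardmax_flow_segment (sigma : 'I_n -> 'I_kappa) x :
  (forall i l, C l (x0 i) -> l = sigma i) ->
  (forall i, C (sigma i) (x0 i)) -> (forall j, C j (v j)) ->
  x 0%N = x0 -> hardmax_flow B gamma x ->
  forall t i, x t i = a t *: x0 i + (1 - a t) *: v (sigma i).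
Proof.
move=> usigma Csigma Cv x00 flow; elim=> [|t IH] i.
  by rewrite x00 /a big_nil scale1r subrr scale0r addr0.
have /andP[a0 a1] := decay_gt0_le1 t.
(* A vertex is the start of some particle [i0]; lying in its own cell, it has [sigma i0 = j], so the
   segment of [i0] is a single point. *)
have v_fixed j : range (x t) (v j).
  have /vertices_sub_generators[i0 _ x0v] : vertices K (v j).
    by rewrite -v_vertices; exists j.
  exists i0 => //; rewrite IH -(usigma i0 j); last by rewrite x0v.
  by rewrite x0v -scalerDl addrC subrK scale1r.
have KtK : convex_hull (range (x t)) `<=` K.
  apply: convex_hull_idem => _ [j _ <-]; rewrite IH.
  apply: convex_hull_convex; last by rewrite (ltW a0).
    by apply: convex_hull_sub; exists j.
  exact: K_v.
have [y [Kty [_ ymax]] ->] := flow t i.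
have -> : y = v (sigma i).
  have [//|ylt] := cell_unique_max (usigma i) (Csigma i) (KtK _ Kty).
  have : inner (B *m x t i) (v (sigma i)) <= inner (B *m x t i) y.
    by apply: ymax; exists (v (sigma i)) => //; apply: convex_hull_sub; exact: v_fixed.
  (* The form at [x t i] mixes a strict inequality, of weight [a t > 0], with a weak one coming from
     [v (sigma i)] being in its own cell. *)
  rewrite IH !inner_mulmx_combl leNgt ltr_leD//; first by rewrite ltr_pM2l.
  apply: ler_wpM2l; first by rewrite subr_ge0.
  by have [_ [_]] := Cv (sigma i); apply; exists y => //; exact: KtK.
rewrite IH; apply/colP => k; rewrite !mxE.
by rewrite /a [in RHS]big_nat_recr//= -/(a t); ring.
Qed.

(** Each factor is at most [1 - delta], so the product is at most the corresponding power. The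
    uniform bound provides the rate: for summable steps the product stays away from 0. *)
Lemma decay_le_expR delta : 0 < delta -> (forall t, delta <= gamma t) ->
  forall t, a t <= expR (ln (1 - delta) * t%:R).
Proof.
move=> d0 dg t.
have d1 : 0 < 1 - delta.
  by have /andP[_ g1] := Hgamma 0; rewrite subr_gt0 (le_lt_trans (dg 0)).
rewrite mulrC expRM_natl lnK ?posrE//; elim: t => [|t IH].
  by rewrite /a big_nil expr0.
have /andP[a0 _] := decay_gt0_le1 t; have /andP[_ g1] := Hgamma t.
rewrite exprSr /a big_nat_recr//= ler_pM ?(ltW a0) ?subr_ge0 ?(ltW g1)//.
by rewrite lerD2l lerN2.
Qed.

End Flow.

Theorem theorem4p2 (R : realType) (d n kappa : nat) (B : 'M[R]_d)
    (gamma : nat -> R) (x0 : 'I_n -> 'cV[R]_d) (v : 'I_kappa -> 'cV[R]_d)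
    (K := convex_hull (range x0)) (C := cell B K v)
    (HB : sym_posdef B)
    (Hgamma : forall t, 0 < gamma t < 1)
    (v_inj : injective v)
    (v_vertices : range v = vertices K)
    (H1 : forall j, (C j `\` \bigcup_(i in [set i | i != j]) C i) (v j))
    (H2 : forall i, ~ vertices K (x0 i) ->
            forall k l, k != l -> ~ (C k `&` C l) (x0 i)) :
  (forall i, exists! k, C k (x0 i)) /\
  (forall (sigma : 'I_n -> 'I_kappa) (x : nat -> 'I_n -> 'cV[R]_d),
    (forall i, C (sigma i) (x0 i)) ->
    x 0%N = x0 ->
    hardmax_flow B gamma x ->
    (forall i t,
      x t i = (\prod_(0 <= tau < t) (1 - gamma tau)) *: x0 i +
              \sum_(0 <= tau < t)
                (gamma tau * \prod_(tau.+1 <= s < t) (1 - gamma s))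
                  *: v (sigma i)) /\
    ((exists2 delta : R, 0 < delta & forall t, delta <= gamma t) ->
      forall i, exists C0 c : R, [/\ 0 < C0, 0 < c &
        forall t, enorm (x t i - v (sigma i)) <= C0 * expR (- c * t%:R)])).
Proof.
(* Uniqueness of the cell comes from [H1] for particles starting at a vertex and from [H2] for all
   others. *)
have uC i k l : C k (x0 i) -> C l (x0 i) -> k = l.
  have uv j m : C m (v j) -> m = j.
    have [_ nC] := H1 j => Cm; apply: contrapT => /eqP mj.
    by apply: nC; exists m.
  move=> Ck Cl; have [vx|/H2 nC] := pselect (vertices K (x0 i)).
    have [j _ vj] : range v (x0 i) by rewrite v_vertices.
    by rewrite -vj in Ck Cl; rewrite (uv _ _ Ck) (uv _ _ Cl).
  by apply: contrapT => /eqP kl; exact: nC kl (conj Ck Cl).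
split=> [i|sigma x Csigma x00 flow].
  have Kx0 : K (x0 i) by apply: convex_hull_sub; exists i.
  have [k Ck] := cell_exists B v_vertices Kx0.
  by exists k; split=> // l; exact: uC.
have xE t i := hardmax_flow_segment Hgamma v_vertices
  (fun i l => (uC i l _)^~ (Csigma i)) Csigma (fun j => (H1 j).1) x00 flow t i.
split=> [i t|[delta d0 dg] i]; first by rewrite sum_weights.
have d1 : 0 < 1 - delta < 1.
  have /andP[_ g1] := Hgamma 0%N.
  by rewrite subr_gt0 (le_lt_trans (dg 0%N))//= gtrBl.
(* The added 1 keeps the constant positive when the particle starts at its own limit. *)
exists (enorm (x0 i - v (sigma i)) + 1), (- ln (1 - delta)); split.
- by rewrite ltr_wpDl ?sqrtr_ge0.
- by rewrite oppr_gt0 ln_lt0.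
move=> t; set a := \prod_(0 <= tau < t) (1 - gamma tau).
have /andP[a0 _] := decay_gt0_le1 Hgamma t.
have -> : x t i - v (sigma i) = a *: (x0 i - v (sigma i)).
  by rewrite xE; apply/colP => k; rewrite !mxE -/a; ring.
rewrite enormZ ?(ltW a0)// opprK mulrC ler_pM ?sqrtr_ge0 ?(ltW a0) ?lerDl//.
exact: decay_le_expR.
Qed.
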